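(* Let $G=(V,E)$ be a finite simple connected graph and let $V_1\subseteq V$. Let $d$ be the shortest-path metric of $G$ restricted to $V_1$ (every edge has length $1$). Then \[\mathcal{P}_G\cap\mathbb{R}^{V_1}=KR(V_1,d),\] where $\mathcal{P}_G\cap\mathbb{R}^{V_1}:=\{x\in\mathcal{P}_G : x_i=0 \text{ for all } i\notin V_1\}$.
   Context: For a graph $G=(V,E)$, the symmetric edge polytope is $\mathcal{P}_G:=\mathrm{conv}\{\mathbf{e}_v-\mathbf{e}_w,\ \mathbf{e}_w-\mathbf{e}_v : \{v,w\}\in E\}\subset\mathbb{R}^V$, where $(\mathbf{e}_v)_{v\in V}$ is the standard basis. For a finite metric space $(X,d)$, the Kantorovich--Rubinstein polytope is $KR(X,d):=\mathrm{conv}\{\frac{\mathbf{e}_i-\mathbf{e}_j}{d(i,j)} : i,j\in X\}\subset\mathbb{R}^X\subseteq\mathbb{R}^V$, where for $i=j$ the point is taken to be the origin $\mathbf{0}$.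
   Formalization: The formal theorem assumes that G has at least two vertices and that V_1 is nonempty; otherwise the equality can fail, since the convex hull of the empty set is empty (e.g. G a single vertex with V_1=V, or V_1 empty and G having an edge). *)

(* Defs.v *)
From mathcomp Require Import all_boot all_order all_algebra.
From mathcomp Require Import boolp classical_sets reals convex.

Set Implicit Arguments.
Unset Strict Implicit.
Unset Printing Implicit Defensive.

Import Order.TTheory GRing.Theory Num.Theory.

Local Open Scope classical_set_scope.
Local Open Scope ring_scope.

Definition conv_hull (R : realType) (E : lmodType R) (A : set E) : set E :=
  smallest (@convex_set R E) A.

Definition basis_vec (R : realType) (V : finType) (v : V) : {ffun V -> R^o} :=
  [ffun w => (w == v)%:R].

Section Graph.
Variables (V : finType) (e : rel V).

Definition connected_graph := forall v w : V, connect e v w.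

Definition has_walk (v w : V) (n : nat) : bool :=
  [exists p : n.-tuple V, path e v p && (last v p == w)].

Lemma connect_has_walk v w : connect e v w -> exists n, has_walk v w n.
Proof.
move=> /connectP[p ep ->]; exists (size p).
by apply/existsP; exists (in_tuple p); rewrite ep eqxx.
Qed.

Definition graph_dist (e_conn : connected_graph) (v w : V) : nat :=
  ex_minn (connect_has_walk (e_conn v w)).

End Graph.

Definition sym_edge_polytope (R : realType) (V : finType) (e : rel V) :
    set {ffun V -> R^o} :=
  conv_hull [set x | exists v w : V, e v w /\
    (x = basis_vec R v - basis_vec R w \/ x = basis_vec R w - basis_vec R v)].

Arguments sym_edge_polytope R {V} e _.

(* [X : {set V}] carries the metric [d], of which only the values on [X] matter;
   R^X is viewed inside R^V. *)
Definition KR_polytope (R : realType) (V : finType) (X : {set V})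
    (d : V -> V -> R) : set {ffun V -> R^o} :=
  conv_hull [set x | exists i j : V, [/\ i \in X, j \in X &
    x = if i == j then 0 else (d i j)^-1 *: (basis_vec R i - basis_vec R j)]].

Arguments KR_polytope {R V} X d _.

(* Main.v *)
Require Import Defs.
From mathcomp Require Import all_boot all_order all_algebra.
From mathcomp Require Import interval_inference.
From mathcomp Require Import boolp classical_sets reals convex.
From mathcomp Require Import ring lra.

(** Points of the Kantorovich-Rubinstein polytope of [X] are exactly the
    divergences of nonnegative flows on [X * X] of transport cost at most [1].
    If the divergence of such a flow vanishes at [k], then the mass transiting
    through [k] can be rerouted directly from its sources to its targets, in
    proportion; by the triangle inequality this does not raise the cost.
    Deleting in this way the vertices outside [V1] one at a time, starting from
    a flow along the edges, gives one inclusion. Conversely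
    [(e_i - e_j) / d(i, j)] is the average of the edge vectors along a shortest
    path from [i] to [j]. *)

Set Implicit Arguments.
Unset Strict Implicit.
Unset Printing Implicit Defensive.

Import Order.TTheory GRing.Theory Num.Theory.

Local Open Scope classical_set_scope.
Local Open Scope ring_scope.

(** * Convex hulls and combinations with weights of total at most one *)

Section Convexity.
Variables (R : realType) (E : lmodType R).
Implicit Types (A : set E) (x y : E).

Lemma convex_setE A : @convex_set R E A <->
  forall x y (t : R), 0 <= t -> t <= 1 -> A x -> A y ->
    A (t *: x + (1 - t) *: y).
Proof.
split=> [cA x y t t0 t1 Ax Ay|cA x y t /set_mem Ax /set_mem Ay].
  by have /set_mem := cA x y (Itv01 t0 t1) (mem_set Ax) (mem_set Ay).
by apply/mem_set/cA.
Qed.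

Lemma conv_hull_convex A : @convex_set R E (conv_hull A).
Proof.
apply/convex_setE => x y t t0 t1 hx hy M [cM AM].
by move/convex_setE: (cM); apply => //; [apply: hx|apply: hy].
Qed.

(** Writing the combination as a multiple of a point of [A] leaves the weights unnormalised, so sums
    can be built term by term. If [a + b] vanishes, any point of [A] serves. *)
Lemma convex_set_weightedD A a b x y : @convex_set R E A ->
  0 <= a -> 0 <= b -> A x -> A y ->
  exists2 z, A z & a *: x + b *: y = (a + b) *: z.
Proof.
move=> /convex_setE cA a0 b0 Ax Ay.
have [ab0|ab0] := eqVneq (a + b) 0.
  exists x => //; have [-> ->] : a = 0 /\ b = 0 by split; lra.
  by rewrite addr0 !scale0r addr0.
have abp : 0 < a + b by rewrite lt_neqAle eq_sym ab0 addr_ge0.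
exists ((a / (a + b)) *: x + (1 - a / (a + b)) *: y).
  apply: cA => //; first exact: divr_ge0 (ltW abp).
  by rewrite ler_pdivrMr // mul1r lerDl.
by rewrite scalerDr !scalerA; congr (_ *: _ + _ *: _); field.
Qed.

(** The missing weight [1 - \sum_i c i] is put on the origin. *)
Lemma convex_set_sum A (I : finType) (c : I -> R) (a : I -> E) :
  @convex_set R E A -> A 0 -> (forall i, 0 <= c i) -> (forall i, A (a i)) ->
  \sum_i c i <= 1 -> A (\sum_i c i *: a i).
Proof.
move=> cA A0 c0 Aa c1.
have [z Az ->] : exists2 z, A z & \sum_i c i *: a i = (\sum_i c i) *: z.
  elim: (index_enum I) => [|i r [z Az IH]].
    by exists 0; rewrite // !big_nil scale0r.
  rewrite !big_cons IH; apply: convex_set_weightedD => //.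
  exact: sumr_ge0.
move/convex_setE: cA => /(_ z 0 _ (sumr_ge0 _ (fun i _ => c0 i)) c1 Az A0).
by rewrite scaler0 addr0.
Qed.

End Convexity.

(** * Flows, their divergences and the deletion of vertices *)

Section Flows.
Variables (R : realType) (V : finType) (d : V -> V -> R).
Implicit Types (X : {set V}) (x : {ffun V -> R^o}).

(** Flows live on all of [V * V] and vanish off [X * X], so [X] can shrink in a fixed ambient space.
    Loops [f i i] are allowed, since rerouting may create them; they cancel in the divergence. *)
Definition flow_divergences X : set {ffun V -> R^o} := [set x |
  exists f : V -> V -> R, [/\ forall i j, 0 <= f i j,
    forall i j, ~~ ((i \in X) && (j \in X)) -> f i j = 0,
    \sum_i \sum_j f i j * d i j <= 1 &
    forall i, x i = \sum_j f i j - \sum_j f j i]].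

Lemma flow_divergences_convex X :
  @convex_set R {ffun V -> R^o} (flow_divergences X).
Proof.
apply/convex_setE => x y t t0 t1 [f [f0 fX fd xf]] [g [g0 gX gd yg]].
exists (fun i j => t * f i j + (1 - t) * g i j); split.
- by move=> i j; rewrite addr_ge0 // mulr_ge0 // subr_ge0.
- by move=> i j ij; rewrite fX // gX // !mulr0 addr0.
- have -> : \sum_i \sum_j (t * f i j + (1 - t) * g i j) * d i j =
      t * (\sum_i \sum_j f i j * d i j) +
      (1 - t) * (\sum_i \sum_j g i j * d i j).
    rewrite !mulr_sumr -big_split; apply: eq_bigr => i _.
    rewrite !mulr_sumr -big_split; apply: eq_bigr => j _ /=; ring.
  nra.
- move=> i; rewrite !ffunE xf yg /= !big_split /= -!mulr_sumr.
  rewrite /GRing.scale /=; ring.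
Qed.

Lemma flow_divergences_basis X i j : i \in X -> j \in X -> 0 < d i j ->
  flow_divergences X ((d i j)^-1 *: (basis_vec R i - basis_vec R j)).
Proof.
move=> iX jX dij.
(* Ship [1 / d i j] from [i] to [j] and nothing else: the cost is exactly 1. *)
exists (fun k l => ((k == i) && (l == j))%:R / d i j); split.
- by move=> k l; rewrite divr_ge0 // ltW.
- move=> k l; case: (eqVneq k i) => [->|_]; last by rewrite mul0r.
  by case: (eqVneq l j) => [->|_]; rewrite ?mul0r // iX jX.
- rewrite (bigD1 i) //= (bigD1 j) //= !eqxx mul1r mulVf ?gt_eqF //.
  rewrite !big1 ?addr0 //.
    by move=> k /negPf ki; rewrite big1 // => l _; rewrite ki !mul0r.
  by move=> l /negPf lj; rewrite lj !mul0r.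
- move=> k; rewrite !ffunE -!mulr_suml.
  rewrite (bigD1 j) //= eqxx andbT [X in (_ + X) / _]big1 ?addr0; last first.
    by move=> l /negPf ->; rewrite andbF.
  rewrite (bigD1 i) //= eqxx [X in _ - (_ + X) / _]big1 ?addr0; last first.
    by move=> l /negPf ->.
  rewrite /GRing.scale /=; ring.
Qed.

Lemma flow_divergences_0 X : flow_divergences X 0.
Proof.
exists (fun _ _ => 0); split => //.
  by rewrite big1 ?ler01 // => i _; rewrite big1 // => j _; rewrite mul0r.
by move=> i; rewrite ffunE big1 // subr0.
Qed.

Hypothesis d_ge0 : forall i j, 0 <= d i j.
Hypothesis d_gt0 : forall i j, i != j -> 0 < d i j.
Hypothesis d_triangle : forall i j k, d i k <= d i j + d j k.

Lemma divergence_basisE x (f : V -> V -> R) :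
  (forall i, x i = \sum_j f i j - \sum_j f j i) ->
  x = \sum_i \sum_j f i j *: (basis_vec R i - basis_vec R j).
Proof.
move=> xf; apply/ffunP => k; rewrite xf.
have -> : \sum_i \sum_j f i j *: (basis_vec R i - basis_vec R j) =
    \sum_i \sum_j f i j *: basis_vec R i - \sum_i \sum_j f i j *: basis_vec R j.
  rewrite -sumrB; apply: eq_bigr => i _.
  by rewrite -sumrB; apply: eq_bigr => j _; rewrite scalerBr.
rewrite !ffunE !sum_ffunE; congr (_ - _).
  rewrite [RHS](bigD1 k) //= [X in _ = _ + X]big1 ?addr0.
    rewrite sum_ffunE; apply: eq_bigr => j _.
    by rewrite !ffunE eqxx /GRing.scale /= mulr1.
  move=> i /negPf ik; rewrite sum_ffunE big1 // => j _.
  by rewrite !ffunE eq_sym ik scaler0.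
apply: eq_bigr => i _; rewrite sum_ffunE (bigD1 k) //= [X in _ + X]big1 ?addr0.
  by rewrite !ffunE eqxx /GRing.scale /= mulr1.
by move=> j /negPf jk; rewrite !ffunE eq_sym jk scaler0.
Qed.

(** A flow [f] weights the generator of the pair [(i, j)] by [f i j * d i j], so the cost is the
    total weight. As [X] is nonempty, the case [i = j] puts the origin in the hull, where it absorbs
    the remaining weight. *)
Lemma KR_polytope_flows X : (0 < #|X|)%N ->
  KR_polytope X d = flow_divergences X.
Proof.
move=> /card_gt0P[u uX]; apply/seteqP; split.
  apply: smallest_sub; first exact: flow_divergences_convex.
  move=> _ [i [j [iX jX ->]]]; have [_|ij] := eqVneq i j.
    exact: flow_divergences_0.
  exact/flow_divergences_basis/d_gt0.
move=> x [f [f0 fX fd /divergence_basisE ->]].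
have KR0 : KR_polytope X d 0.
  by apply: sub_gen_smallest; exists u, u; rewrite eqxx.
pose a i j := if (i \in X) && (j \in X) && (i != j)
  then (d i j)^-1 *: (basis_vec R i - basis_vec R j) else 0.
have -> : \sum_i \sum_j f i j *: (basis_vec R i - basis_vec R j) =
    \sum_(p : V * V) (f p.1 p.2 * d p.1 p.2) *: a p.1 p.2.
  rewrite pair_big /=; apply: eq_bigr => -[i j] _ /=; rewrite /a.
  have [ijX|ijX] := boolP ((i \in X) && (j \in X)); last first.
    by rewrite fX // mul0r !scale0r.
  have [->|ij] := eqVneq i j; first by rewrite subrr !scaler0.
  by rewrite scalerA mulfK // gt_eqF // d_gt0.
apply: convex_set_sum => //; first exact: conv_hull_convex.
- by move=> p; rewrite mulr_ge0.
- move=> [i j]; rewrite /a /=; case: ifP => // /andP[/andP[iX jX] /negPf ij].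
  by apply: sub_gen_smallest; exists i, j; rewrite ij.
- by rewrite -(pair_big predT predT (fun i j => f i j * d i j)).
Qed.

Lemma flow_divergences_elim X x k : flow_divergences X x -> x k = 0 ->
  flow_divergences (X :\ k) x.
Proof.
move=> [f [f0 fX fd xf]] xk.
(* [F] is the mass entering [k] from other vertices; as the divergence at [k] is zero, it is also
   the mass leaving [k] for other vertices. *)
pose F := \sum_(i | i != k) f i k.
have F_out : \sum_(j | j != k) f k j = F.
  move/eqP: xk; rewrite xf (bigD1 k) //= [X in _ - X](bigD1 k) //= -/F.
  by rewrite opprD addrACA subrr add0r subr_eq0 => /eqP.
have F_ge0 : 0 <= F by apply: sumr_ge0.
(* If [F = 0], nothing transits through [k], so [inF] and [outF] below survive the convention that
   division by zero gives zero. *)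
have in0 i : i != k -> F = 0 -> f i k = 0.
  move=> ik /eqP; rewrite psumr_eq0 // => /allP/(_ i).
  by rewrite mem_index_enum ik => /(_ isT)/eqP.
have out0 j : j != k -> F = 0 -> f k j = 0.
  rewrite -F_out => jk /eqP; rewrite psumr_eq0 // => /allP/(_ j).
  by rewrite mem_index_enum jk => /(_ isT)/eqP.
have inF i : i != k -> \sum_(j | j != k) f i k * f k j / F = f i k.
  move=> ik; rewrite -mulr_suml -mulr_sumr F_out.
  by have [/(in0 _ ik) ->|F0] := eqVneq F 0; rewrite ?mul0r ?mulfK.
have outF j : j != k -> \sum_(i | i != k) f i k * f k j / F = f k j.
  move=> jk; rewrite -mulr_suml -mulr_suml -/F.
  have [/(out0 _ jk) ->|F0] := eqVneq F 0; first by rewrite mulr0 mul0r.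
  by rewrite mulrAC divff // mul1r.
(* Of the mass [f i k], the fraction [f k j / F] is sent straight to [j]. *)
pose g i j := if (i != k) && (j != k) then f i j + f i k * f k j / F else 0.
have gk i : g i k = 0 by rewrite /g eqxx andbF.
have kg j : g k j = 0 by rewrite /g eqxx.
have gE i j : i != k -> j != k -> g i j = f i j + f i k * f k j / F.
  by rewrite /g => -> ->.
exists g; split.
- move=> i j; rewrite /g; case: ifP => // _.
  by rewrite addr_ge0 // divr_ge0 // mulr_ge0.
- move=> i j; rewrite /g !inE; case: (i != k) => //; case: (j != k) => //=.
  rewrite negb_and => ijX; rewrite fX ?negb_and // add0r.
  case/orP: ijX => [iX|jX]; first by rewrite (fX i k) ?(negPf iX) // !mul0r.
  by rewrite (fX k j) ?(negPf jX) ?andbF // mulr0 mul0r.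
- apply: le_trans fd.
  rewrite (bigD1 k) //= big1 ?add0r => [|j _]; last by rewrite kg mul0r.
  rewrite [leRHS](bigD1 k) //=.
  have -> : \sum_(i | i != k) \sum_j g i j * d i j =
      \sum_(i | i != k) \sum_(j | j != k) f i j * d i j +
      \sum_(i | i != k) \sum_(j | j != k) f i k * f k j / F * d i j.
    rewrite -big_split; apply: eq_bigr => i ik /=.
    rewrite (bigD1 k) //= gk mul0r add0r -big_split; apply: eq_bigr => j jk /=.
    by rewrite gE // mulrDl.
  have reroute : \sum_(i | i != k) \sum_(j | j != k) f i k * f k j / F * d i j
      <= \sum_(i | i != k) f i k * d i k + \sum_(j | j != k) f k j * d k j.
    (* Expanding [f i k] by [inF] and [f k j] by [outF] turns the right side into a double sum of
       [f i k * f k j / F * (d i k + d k j)]; the triangle inequality then applies termwise. *)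
    rewrite -(eq_bigr _ (fun i ik => congr1 ( *%R^~ _) (inF i ik))).
    rewrite -[X in _ <= _ + X](eq_bigr _
      (fun j jk => congr1 ( *%R^~ _) (outF j jk))).
    rewrite -[X in _ <= _ + X](eq_bigr _ (fun j _ => esym (mulr_suml _ _ _ _))).
    rewrite [X in _ <= _ + X]exchange_big /= -big_split /=.
    apply: ler_sum => i ik; rewrite mulr_suml -big_split /=.
    apply: ler_sum => j jk; rewrite -mulrDr ler_wpM2l //.
    by rewrite divr_ge0 // mulr_ge0.
  have split_k : \sum_(i | i != k) \sum_j f i j * d i j =
      \sum_(i | i != k) f i k * d i k +
      \sum_(i | i != k) \sum_(j | j != k) f i j * d i j.
    by rewrite -big_split; apply: eq_bigr => i ik; rewrite (bigD1 k).
  have out_le : \sum_(j | j != k) f k j * d k j <= \sum_j f k j * d k j.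
    by rewrite [leRHS](bigD1 k) //= lerDr mulr_ge0.
  lra.
- move=> i; have [->|ik] := eqVneq i k.
    by rewrite xk !big1 ?subr0 // => j _; rewrite ?gk ?kg.
  (* Row and column sums at [i] are unchanged: the deleted entries [f i k] and [f k i] return as
     rerouted shares. *)
  rewrite xf; congr (_ - _); rewrite (bigD1 k) //= [RHS](bigD1 k) //=.
    rewrite gk add0r -(inF _ ik) addrC -big_split.
    by apply: eq_bigr => j jk; rewrite gE.
  rewrite kg add0r -(outF _ ik) addrC -big_split.
  by apply: eq_bigr => j jk; rewrite gE.
Qed.

Lemma flow_divergences_support X x : flow_divergences [set: V] x ->
  (forall i, i \notin X -> x i = 0) -> flow_divergences X x.
Proof.
move=> hx x0.
have: forall s : seq V, {subset s <= ~: X} ->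
    flow_divergences (~: [set i in s]) x.
  elim=> [_|i s IH /allP/= /andP[iX /allP sX]].
    by rewrite (_ : ~: _ = [set: V]%SET) //; apply/setP => i; rewrite !inE.
  have -> : ~: [set j in i :: s] = (~: [set j in s]) :\ i.
    by apply/setP => j; rewrite !inE negb_or.
  by apply: flow_divergences_elim; [exact: IH|apply: x0; rewrite inE in iX].
move=> /(_ (enum (~: X))); rewrite set_enum finset.setCK; apply => i.
by rewrite mem_enum.
Qed.

End Flows.

(** * The shortest-path distance as a metric *)

Section GraphDistance.
Variables (V : finType) (e : rel V) (e_conn : connected_graph e).

Lemma graph_dist_path v w :
  exists p, [/\ path e v p, last v p = w & size p = graph_dist e_conn v w].
Proof.
rewrite /graph_dist; case: ex_minnP => n /existsP[p /andP[ep /eqP lp]] _.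
by exists p; rewrite size_tuple.
Qed.

Lemma graph_dist_le v p : path e v p ->
  (graph_dist e_conn v (last v p) <= size p)%N.
Proof.
move=> ep; rewrite /graph_dist; case: ex_minnP => n _; apply.
by apply/existsP; exists (in_tuple p); rewrite ep eqxx.
Qed.

Lemma graph_dist_gt0 v w : v != w -> (0 < graph_dist e_conn v w)%N.
Proof.
by have [[|x p] [_ /= <- <-]] := graph_dist_path v w; rewrite ?eqxx.
Qed.

Lemma graph_dist_triangle u v w :
  (graph_dist e_conn u w <= graph_dist e_conn u v + graph_dist e_conn v w)%N.
Proof.
have [p [ep lp <-]] := graph_dist_path u v.
have [q [eq lq <-]] := graph_dist_path v w.
have := @graph_dist_le u (p ++ q).
by rewrite cat_path last_cat size_cat lp ep eq lq => /(_ isT).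
Qed.

(** The edge is itself a walk of length 1, and irreflexivity excludes distance 0. *)
Lemma graph_dist_edge v w : irreflexive e -> e v w ->
  graph_dist e_conn v w = 1%N.
Proof.
move=> e_irr evw; apply/eqP; rewrite eqn_leq.
have := @graph_dist_le v [:: w]; rewrite /= evw => -> //=.
by apply: graph_dist_gt0; apply: contraTneq evw => ->; rewrite e_irr.
Qed.

Lemma connected_graph_edge : (1 < #|V|)%N -> exists v w, e v w.
Proof.
move=> /card_gt1P[v [w [_ _ vw]]].
have [[|x p] [/= ep lp _]] := graph_dist_path v w.
  by rewrite lp eqxx in vw.
by exists v, x; case/andP: ep.
Qed.

End GraphDistance.

(** * Points of the symmetric edge polytope *)

Section EdgePolytope.
Variables (R : realType) (V : finType) (e : rel V).

Lemma sym_edge_polytope_convex :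
  @convex_set R {ffun V -> R^o} (sym_edge_polytope R e).
Proof. exact: conv_hull_convex. Qed.

Lemma sym_edge_polytope_edge v w : e v w ->
  sym_edge_polytope R e (basis_vec R v - basis_vec R w).
Proof. by move=> evw; apply: sub_gen_smallest; exists v, w; split; [|left]. Qed.

(** The origin is the midpoint of two opposite edge vectors. *)
Lemma sym_edge_polytope_0 v w : e v w -> sym_edge_polytope R e 0.
Proof.
move=> evw; have /convex_setE cP := sym_edge_polytope_convex.
have -> : 0 = 2^-1 *: (basis_vec R v - basis_vec R w) +
    (1 - 2^-1) *: (basis_vec R w - basis_vec R v).
  rewrite -[X in _ + _ *: X]opprB scalerN -scalerBl.
  by rewrite (_ : _ - _ = 0) ?scale0r //; field.
apply: cP; [by lra|by lra|exact: sym_edge_polytope_edge|].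
by apply: sub_gen_smallest; exists v, w; split; [|right].
Qed.

(** The difference telescopes into [size p] edge vectors, and [y] is their average; the origin
    serves for the empty path. *)
Lemma sym_edge_polytope_path v p : sym_edge_polytope R e 0 -> path e v p ->
  exists2 y, sym_edge_polytope R e y &
    basis_vec R v - basis_vec R (last v p) = (size p)%:R *: y.
Proof.
move=> P0; elim: p v => [v _|w p IH v /= /andP[evw ep]].
  by exists 0; rewrite // subrr scaler0.
have [y Py hy] := IH w ep.
have := convex_set_weightedD sym_edge_polytope_convex ler01
  (ler0n R (size p)) (sym_edge_polytope_edge evw) Py.
by rewrite scale1r -hy addrA subrK nat1r.
Qed.

Lemma sym_edge_polytope_dist (e_conn : connected_graph e) i j :
  sym_edge_polytope R e 0 -> i != j ->
  sym_edge_polytope R e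
    ((graph_dist e_conn i j)%:R^-1 *: (basis_vec R i - basis_vec R j)).
Proof.
move=> P0 ij; have [p [ep lp sp]] := graph_dist_path e_conn i j.
have [y Py] := sym_edge_polytope_path P0 ep; rewrite lp sp => ->.
by rewrite scalerA mulVf ?scale1r // pnatr_eq0 -lt0n graph_dist_gt0.
Qed.

End EdgePolytope.

Unset Implicit Arguments.

Theorem theorem2p5 (R : realType) (V : finType) (e : rel V)
    (e_sym : symmetric e) (e_irr : irreflexive e)
    (e_conn : connected_graph e) (V_gt1 : (1 < #|V|)%N)
    (V1 : {set V}) (V1_gt0 : (0 < #|V1|)%N) :
  [set x | sym_edge_polytope R e x /\ forall i : V, i \notin V1 -> x i = 0] =
  KR_polytope V1 (fun i j => (graph_dist e_conn i j)%:R : R).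
Proof.
(* An edge puts the origin in the edge polytope; with no edges that polytope would be empty, while
   the right side contains the origin. *)
have [v [w evw]] := connected_graph_edge e_conn V_gt1.
have P0 := @sym_edge_polytope_0 R V e v w evw.
pose d i j : R := (graph_dist e_conn i j)%:R; rewrite -/d.
have d_gt0 i j : i != j -> 0 < d i j.
  by move=> ij; rewrite ltr0n graph_dist_gt0.
have d_triangle i j k : d i k <= d i j + d j k.
  by rewrite /d -natrD ler_nat graph_dist_triangle.
have d_ge0 i j : 0 <= d i j by exact: ler0n.
apply/seteqP; split=> [x [Px x0]|].
  rewrite KR_polytope_flows //; apply: flow_divergences_support => //.
  move: x Px {x0}; apply: smallest_sub.
    exact: flow_divergences_convex.
  (* An edge has length 1, so a unit of flow along it costs exactly 1. *)
  have flow_edge a b : e a b ->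
      flow_divergences d [set: V] (basis_vec R a - basis_vec R b).
    move=> eab; have dab : d a b = 1 by rewrite /d graph_dist_edge.
    have := @flow_divergences_basis R V d [set: V]%SET a b.
    by rewrite dab invr1 scale1r; apply; rewrite ?inE.
  by move=> _ [a [b [eab [|] ->]]]; apply: flow_edge; rewrite // e_sym.
(* The slice is convex, so it is enough to place the generators in it; these are supported on
   [V1]. *)
apply: smallest_sub.
  apply/convex_setE => x y t t0 t1 [Px x0] [Py y0]; split.
    by have /convex_setE := @sym_edge_polytope_convex R V e; apply.
  by move=> i iV1; rewrite !ffunE x0 // y0 // !scaler0 addr0.
move=> _ [i [j [iV1 jV1 ->]]]; have [_|ij] := eqVneq i j.
  by split=> // k _; rewrite ffunE.
split=> [|k kV1]; first exact: sym_edge_polytope_dist.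
have kE l : l \in V1 -> (k == l) = false.
  by move=> lV1; apply: contraNF kV1 => /eqP ->.
by rewrite !ffunE !kE // subrr scaler0.
Qed.
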